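(* Let $E$ be a Banach space and let $X$ be a closed subspace of $E$. If $Z$ is a $w^*$-closed subspace of $E^*$, then the following assertions are equivalent: (1) $Z$ is norming for $X$ and $X$ is total over $Z$. (2) $X$ is norming for $Z$ and $Z$ is total over $X$. (3) $X$ is norming for $Z$ and $Z$ is norming for $X$. (4) $E = X \oplus Z_{\perp}$.
   Context: $E^*$ is the dual of the Banach space $E$, and $w^*$ denotes the weak-star topology $\sigma(E^*,E)$ on $E^*$. $B_Y$ denotes the unit ball of a normed space $Y$. For a subspace $X\subset E$ and a subspace $Z\subset E^*$: - $Z_{\perp} = \{x\in E : f(x)=0 \text{ for every } f\in Z\}$ and $X^{\perp} = \{f\in E^* : f(x)=0 \text{ for every } x\in X\}$. - $Z$ is norming for $X$ if the formula $|||x||| = \sup_{f\in B_Z}|f(x)|$, $x\in X$, defines an equivalent norm on $X$. - $X$ is norming for $Z$ if the image of $X$ under the canonical map $\pi: E\to E^{**}$ is norming for $Z$, i.e. the formula $|||f||| = \sup_{x\in B_X}|f(x)|$, $f\in Z$, defines an equivalent norm on $Z$. - $Z$ is total over $X$ if $X\cap Z_{\perp}=\{0\}$. - $X$ is total over $Z$ if $X^{\perp}\cap Z=\{0\}$. $E = X\oplus Z_{\perp}$ means that $X\cap Z_{\perp}=\{0\}$ and $X+Z_{\perp}=E$. *)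

(* Defs.v *)
From HB Require Import structures.
From mathcomp Require Import all_boot all_order all_algebra.
From mathcomp Require Import complex.
From mathcomp Require Import all_classical all_reals all_analysis.

Set Implicit Arguments.
Unset Strict Implicit.
Unset Printing Implicit Defensive.

Import Order.TTheory GRing.Theory Num.Theory.
Import numFieldNormedType.Exports.

Local Open Scope classical_set_scope.
Local Open Scope ring_scope.

(* Banach spaces are real or complex.  Norms of a [normedModType K] live in [K];
   when [K] is [R[i]], [x <= y] means that [y - x] is a nonnegative real, so
   bounds and suprema of norms in [R[i]] are those computed in [R]. *)
Variant scalar_field (R : realType) : numFieldType -> Prop :=
  | real_scalars : scalar_field R R
  | complex_scalars : scalar_field R R[i].

Section dual_space.
Context {K : numFieldType} (E : normedModType K).

Definition is_functional : {pred (E -> K^o)} :=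
  [pred f : E -> K^o | `[< linear f /\ continuous f >]].

Lemma is_functional_submod_closed : submod_closed is_functional.
Proof.
split=> [|a f g].
  apply/asboolP; split=> [k x y|x]; last exact: cvg_cst.
  by rewrite /GRing.zero /= scaler0 addr0.
move=> /asboolP[lf cf] /asboolP[lg cg]; apply/asboolP; split.
  move=> k x y; change (a *: f (k *: x + y) + g (k *: x + y) =
    k *: (a *: f x + g x) + (a *: f y + g y)).
  by rewrite lf lg !scalerDr !scalerA (mulrC a k) addrACA.
by move=> x; apply: cvgD (cg x); apply: cvgZr; exact: cf.
Qed.

HB.instance Definition _ :=
  GRing.isSubmodClosed.Build K (E -> K^o) is_functional
    is_functional_submod_closed.

Record dual := Dual {
  dual_val :> E -> K^o;
  dual_valP : dual_val \in is_functional }.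

HB.instance Definition _ := [isSub for dual_val].
HB.instance Definition _ := [Choice of dual by <:].
HB.instance Definition _ := [SubChoice_isSubLmodule of dual by <:].

(* sigma(E^*, E): the coarsest topology making every evaluation
   [f |-> f x] continuous. *)
Definition weak_star : Type :=
  sup_topology (fun x : E =>
    Topological.class (initial_topology (fun f : dual => f x))).

HB.instance Definition _ := Topological.on weak_star.

End dual_space.

Section norming.
Context {K : numFieldType} {E : normedModType K}.
Implicit Types (X : set E) (Z : set (dual E)).

Definition is_subspace (V : lmodType K) (Y : set V) : Prop :=
  submod_closed [in Y].

Definition unit_ball X : set E := [set x | X x /\ `|x| <= 1].

Definition dual_norm (f : dual E) : K :=
  supremum 0 [set `|f x| | x in unit_ball setT].

Definition dual_unit_ball Z : set (dual E) := [set f | Z f /\ dual_norm f <= 1].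

Definition preannihilator Z : set E := [set x | forall f, Z f -> f x = 0].

Definition annihilator X : set (dual E) := [set f | forall x, X x -> f x = 0].

Definition is_norm_on (V : lmodType K) (Y : set V) (N : V -> K) : Prop :=
  [/\ forall y, Y y -> 0 <= N y,
      forall y, Y y -> N y = 0 -> y = 0,
      forall a y, Y y -> N (a *: y) = `|a| * N y &
      forall y z, Y y -> Y z -> N (y + z) <= N y + N z].

Definition equivalent_norm_on (V : lmodType K) (Y : set V) (N0 N : V -> K) :
    Prop :=
  is_norm_on Y N /\
  exists c C : K, [/\ 0 < c, 0 < C &
    forall y, Y y -> c * N0 y <= N y <= C * N0 y].

(* For subspaces [X] and [Z], the sets under the suprema contain 0 and are
   bounded by [`|x|], resp. [dual_norm f], so they do have a supremum. *)
Definition norming_for Z X : Prop :=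
  equivalent_norm_on X (fun x => `|x|)
    (fun x => supremum 0 [set `|f x| | f in dual_unit_ball Z]).

(* [X] is norming for [Z], [X] acting on [E^*] by evaluation. *)
Definition conorming_for X Z : Prop :=
  equivalent_norm_on Z dual_norm
    (fun f => supremum 0 [set `|f x| | x in unit_ball X]).

Definition total_over Z X : Prop := X `&` preannihilator Z = [set 0].

(* [X] is total over [Z]. *)
Definition cototal_over X Z : Prop := annihilator X `&` Z = [set 0].

Definition direct_sum (X Y : set E) : Prop :=
  X `&` Y = [set 0] /\ [set x + y | x in X & y in Y] = setT.

End norming.

(* Main.v *)
Require Import Defs.
From HB Require Import structures.
From mathcomp Require Import all_boot all_order all_algebra.
From mathcomp Require Import complex ring.
From mathcomp Require Import all_classical all_reals all_analysis.

Import Order.TTheory GRing.Theory Num.Theory.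
Import numFieldNormedType.Exports.

Local Open Scope classical_set_scope.
Local Open Scope ring_scope.

Set Implicit Arguments.
Unset Strict Implicit.
Unset Printing Implicit Defensive.

(** Write Y for the preannihilator of Z.

    Since Z is weak-star closed, Z is the annihilator of Y
    ([weak_star_closed_bipolar]): on any finite set of vectors, a functional
    vanishing on Y agrees with an element of Z.

    Given E = X + Y with trivial intersection, the projection onto X along Y is
    bounded, by Baire category and successive approximation
    ([direct_sum_bounded_projection]).  Functionals in Z factor through the
    projection, so X is norming for Z; the Hahn-Banach theorem applied to the
    distance to Y produces enough elements of the unit ball of Z to norm X.

    A norming hypothesis in either direction gives the direct sum through one
    seminorm on E, the infimum of a |x| + |v - x - y| over x in X and y in Y
    ([sum_cost]).  A Hahn-Banach functional attaining it at e vanishes on Y,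
    hence lies in Z, and is at most a on the unit ball of X.  If X is total over
    Z, taking a = 0 kills the functional, so X + Y is dense, and the bound of |x|
    by |x + y| when Z norms X makes the approximations uniform.  If X norms Z, a
    small a > 0 makes the functional small.  In both cases every e is
    approximated within |e| / 2 by some x + y with |x| at most a fixed multiple
    of |e|, and successive approximation ([sum_of_half_approximation]) shows
    that X + Y = E.  A norming hypothesis contains the totality in the same
    direction, and this closes the cycle of implications.

    The Hahn-Banach theorem is proved for seminorms on real vector spaces by
    minimal sublinear functionals, and transferred to complex ones by
    restriction of scalars. *)

(** * Real and complex scalars *)

(** Nonnegative elements of [K] are real, so the existence of suprema and the
archimedean property are transported along this embedding instead of being
proved once for each kind of scalars. *)
Lemma real_embedding (R : realType) (K : numFieldType) :
  scalar_field R K ->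
  exists iota : {rmorphism R -> K},
    (forall r s, (iota r <= iota s) = (r <= s)) /\
    (forall x, x \is Num.real -> exists r, x = iota r).
Proof.
case; first by exists idfun; split=> // x _; exists x.
exists (real_complex R); split=> [r s|x /complex_realP[r ->]]; first exact: lecR.
by exists r.
Qed.

Lemma supremum_isLub (R : realType) (K : numFieldType) (A : set K) (b : K) :
  scalar_field R K -> A !=set0 -> (forall a, A a -> 0 <= a <= b) ->
  isLub A (supremum 0 A).
Proof.
move=> hK A0 Ab.
have [iota [le_iota iotaP]] := real_embedding hK.
suff [s ss] : supremums A !=set0.
  rewrite /supremum; case: ifPn => [/eqP A_0|_].
    by case: A0 => x; rewrite A_0.
  by case: xgetP => [y -> //|/(_ s)].
have iota_real x : 0 <= x -> exists r, x = iota r.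
  by move=> x0; apply/iotaP/ger0_real.
have [a0 Aa0] := A0.
have [B bB] : exists B, b = iota B.
  by apply: iota_real; have /andP[/le_trans ] := Ab _ Aa0; apply.
pose A' := [set r | A (iota r)].
have supA' : has_sup A'.
  split.
    have /andP[/iota_real[r ar] _] := Ab _ Aa0.
    by exists r; rewrite /A' /= -ar.
  by exists B => r /Ab /andP[_]; rewrite bB le_iota.
exists (iota (sup A')); split=> [a Aa|c ubc].
  have /andP[/iota_real[r ar] _] := Ab _ Aa.
  by rewrite ar le_iota; apply: sup_upper_bound => //; rewrite /A' /= -ar.
have /iota_real[r cr] : 0 <= c.
  by apply: le_trans (ubc _ Aa0); have /andP[] := Ab _ Aa0.
rewrite cr le_iota; apply: ge_sup; first by case: supA'.
by move=> t At; rewrite -le_iota -cr; exact: ubc.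
Qed.

Lemma exists_half_pow_lt (R : realType) (K : numFieldType) (a b : K) :
  scalar_field R K -> 0 <= a -> 0 < b -> exists n, a / 2 ^+ n < b.
Proof.
move=> hK a0 b0; have [iota [le_iota iotaP]] := real_embedding hK.
have [r ar] := iotaP _ (ger0_real (divr_ge0 a0 (ltW b0))).
pose n := (Num.truncn r).+1; exists n.
rewrite ltr_pdivrMr ?exprn_gt0// mulrC -ltr_pdivrMr// ar.
have lt_iota s t : (iota s < iota t) = (s < t).
  by rewrite !lt_neqAle le_iota (inj_eq (fmorph_inj iota)).
rewrite -[2 : K](rmorph_nat iota) -rmorphXn lt_iota.
apply: (lt_trans (truncnS_gt r)).
by rewrite -natrX ltr_nat ltn_expl.
Qed.

Lemma ge0_leNgt (K : numDomainType) (x y : K) : 0 <= x -> 0 <= y ->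
  (x <= y) = ~~ (y < x).
Proof. by move=> x0 y0; rewrite real_leNgt ?ger0_real. Qed.

(** * Sublinear functionals on real vector spaces *)

Section sublinear.
Context {R : realType} {V : lmodType R}.
Implicit Types (p q : V -> R) (G : set (V -> R)).

Definition sublinear p :=
  (forall u v, p (u + v) <= p u + p v) /\
  (forall t u, 0 <= t -> p (t *: u) = t * p u).

Lemma sublinear0 p : sublinear p -> p 0 = 0.
Proof. by case=> _ /(_ 0 0 (lexx _)); rewrite scale0r mul0r. Qed.

Lemma sublinear_geN p u : sublinear p -> - p (- u) <= p u.
Proof.
move=> sp; rewrite -subr_ge0 opprK.
by have := sp.1 u (- u); rewrite subrr sublinear0.
Qed.

(** The two hypotheses on pairs and on multiples say that [G] is directed just
enough for the infimum to inherit subadditivity and homogeneity; they cover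
both chains and the shifts of one functional along a ray.  The function [m]
keeps the infimum finite. *)
Lemma inf_sublinear G (m : V -> R) :
  G !=set0 -> (forall g, G g -> g 0 = 0) ->
  (forall g u, G g -> m u <= g u) ->
  (forall g h u v, G g -> G h ->
     exists2 k, G k & k (u + v) <= g u + h v) ->
  (forall g t u, G g -> 0 < t -> exists2 k, G k & k (t *: u) <= t * g u) ->
  sublinear (fun u => inf [set g u | g in G]).
Proof.
move=> [g0 Gg0] G0 mG GD GZ.
set q := fun u => _.
have neq0 u : [set g u | g in G] !=set0 by exists (g0 u), g0.
have lb u : has_lbound [set g u | g in G].
  by exists (m u) => _ [g Gg <-]; exact: mG.
have q_le g u : G g -> q u <= g u by move=> Gg; apply: ge_inf => //; exists g.
have le_q c u : (forall g, G g -> c <= g u) -> c <= q u.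
  by move=> cG; apply: lb_le_inf => // _ [g Gg <-]; exact: cG.
have leZ t u : 0 < t -> q (t *: u) <= t * q u.
  move=> t0; rewrite -ler_pdivrMl//; apply/le_q => g Gg.
  rewrite ler_pdivrMl//; have [k Gk] := GZ _ _ u Gg t0.
  by apply: le_trans; exact: q_le.
split=> [u v|t u].
  rewrite -lerBlDr; apply/le_q => g Gg.
  rewrite lerBlDr -lerBlDl; apply/le_q => h Gh.
  rewrite lerBlDl; have [k Gk] := GD _ _ u v Gg Gh.
  by apply: le_trans; exact: q_le.
rewrite le_eqVlt => /predU1P[<-|t0].
  rewrite scale0r mul0r; apply/le_anti/andP; split.
    by rewrite -(G0 _ Gg0); exact: q_le.
  by apply/le_q => g /G0 ->.
apply/le_anti/andP; split; first exact: leZ.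
rewrite -ler_pdivlMl//.
by have := leZ t^-1 (t *: u); rewrite invr_gt0 scalerA mulVf ?gt_eqF// scale1r; apply.
Qed.

(** The functional [q'] is the infimum over [t >= 0] of
[q (u + t *: a) - t * q a].  Both ways of forcing linearity rest on it: if [q]
is minimal then [q' = q] and the last bound gives superadditivity, and at
[u = - a] the same bound makes the value at [a] as large as [q a]. *)
Lemma sublinear_shift q a : sublinear q ->
  exists q', [/\ sublinear q', forall u, q' u <= q u &
                 forall u, q' u <= q (u + a) - q a].
Proof.
move=> sq; have [qD qZ] := sq.
pose g t u : R := q (u + t *: a) - t * q a.
pose G := [set g t | t in [set t | 0 <= t]].
have mG h u : G h -> - q (- u) <= h u.
  move=> [t /= t0 <-]; rewrite /g -qZ// -subr_ge0 opprK.
  by have := qD (u + t *: a) (- u); rewrite (addrC u) addrK addrAC subr_ge0.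
have lb u : has_lbound [set h u | h in G].
  by exists (- q (- u)) => _ [h Gh <-]; exact: mG.
exists (fun u => inf [set h u | h in G]); split.
- apply: inf_sublinear mG _ _.
  + by exists (g 0), 0 => //=.
  + by move=> _ [t /= t0 <-]; rewrite /g add0r qZ// subrr.
  + move=> _ _ u v [s /= s0 <-] [t /= t0 <-].
    exists (g (s + t)); first by exists (s + t) => //=; exact: addr_ge0.
    rewrite /g scalerDl addrACA mulrDl.
    by rewrite opprD [leRHS]addrACA lerD2r; exact: qD.
  + move=> _ c u [t /= t0 <-] c0; exists (g (c * t)).
      by exists (c * t) => //=; exact/mulr_ge0/t0/ltW.
    by rewrite /g -scalerA -scalerDr (qZ _ _ (ltW c0)) mulrBr mulrA.
- move=> u; apply: ge_inf => //; exists (g 0); first by exists 0 => /=.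
  by rewrite /g scale0r mul0r addr0 subr0.
- move=> u; apply: ge_inf => //; exists (g 1); first by exists 1 => /=.
  by rewrite /g scale1r mul1r.
Qed.

(** Members of the chain cannot decrease to minus infinity, since
[q u >= - q (- u) >= - p (- u)]. *)
Lemma sublinear_chain p (A : set (V -> R)) :
  sublinear p -> A !=set0 ->
  (forall q, A q -> sublinear q /\ forall u, q u <= p u) ->
  (forall q r, A q -> A r -> (forall u, q u <= r u) \/ (forall u, r u <= q u)) ->
  exists q, sublinear q /\ forall r, A r -> forall u, q u <= r u.
Proof.
move=> sp A0 Ap chainA.
have mA q u : A q -> - p (- u) <= q u.
  move=> /Ap[sq qp]; apply: le_trans (sublinear_geN u sq).
  by rewrite lerN2.
exists (fun u => inf [set q u | q in A]); split; last first.
  move=> r Ar u; apply: ge_inf; last by exists r.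
  by exists (- p (- u)) => _ [q Aq <-]; exact: mA.
apply: inf_sublinear mA _ _ => //.
- by move=> q /Ap[sq _]; exact: sublinear0.
- move=> q r u v Aq Ar; have [[qD _] _] := Ap _ Aq; have [[rD _] _] := Ap _ Ar.
  have [qr|rq] := chainA _ _ Aq Ar.
    by exists q => //; apply: (le_trans (qD _ _)); rewrite lerD2l.
  by exists r => //; apply: (le_trans (rD _ _)); rewrite lerD2r.
- move=> q t u Aq t0; exists q => //.
  by have [[_ qZ] _] := Ap _ Aq; rewrite qZ// ltW.
Qed.

Lemma minimal_sublinear p : sublinear p ->
  exists q, [/\ sublinear q, forall u, q u <= p u &
    forall q', sublinear q' -> (forall u, q' u <= q u) ->
      forall u, q u <= q' u].
Proof.
move=> sp.
pose T := {q | sublinear q /\ forall u, q u <= p u}.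
pose t0 : T := exist _ p (conj sp (fun u => lexx (p u))).
pose S (s t : T) := `[< forall u, sval t u <= sval s u >].
have [||A chainA|[q [sq qp]] qmin] := @ZL_preorder T t0 S.
- by move=> t; apply/asboolP.
- move=> r s t /asboolP rs /asboolP st; apply/asboolP => u.
  exact: le_trans (st u) (rs u).
- have [[t At]|A0] := pselect (A !=set0); last first.
    by exists t0 => s As; case: A0; exists s.
  have [||_ _ [s As <-] [r Ar <-]|q [sq qA]] :=
      @sublinear_chain p [set sval t | t in A] sp.
  + by exists (sval t), t.
  + by move=> _ [s As <-]; exact: (svalP s).
  + by have [/asboolP|/asboolP] := chainA _ _ As Ar; [right|left].
  have qp u : q u <= p u.
    by apply: le_trans ((svalP t).2 u); apply: qA; exists t.
  exists (exist _ q (conj sq qp)) => s As.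
  by apply/asboolP => u; apply: qA; exists s.
- exists q; split=> // q' sq' q'q.
  have q'p u : q' u <= p u := le_trans (q'q u) (qp u).
  by have /asboolP := qmin (exist _ q' (conj sq' q'p)) (asboolT q'q).
Qed.

(** Zorn is applied to total sublinear functionals below [p] rather than to
partial linear ones: a minimal sublinear functional is linear.  Shifting [p]
along [e] beforehand makes the value [p e] at [e] unavoidable. *)
Theorem real_hahn_banach p (e : V) : sublinear p ->
  exists f : V -> R^o,
    [/\ linear f, forall u, f u <= p u & f e = p e].
Proof.
move=> sp; have [pe [spe pe_le pe_e]] := sublinear_shift e sp.
have [f [sf f_le fmin]] := minimal_sublinear spe.
have fD u v : f (u + v) = f u + f v.
  apply/le_anti/andP; split; first exact: sf.1.
  have [f' [sf' f'f f'v]] := sublinear_shift v sf.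
  by rewrite -lerBrDr; apply: le_trans (f'v u); exact: fmin.
have fN u : f (- u) = - f u.
  by apply/eqP; rewrite -addr_eq0 -fD addNr sublinear0.
exists f; split=> [t u v|u|].
- rewrite fD; congr (_ + _); have [t0|/ltW t0] := leP 0 t; first exact: sf.2.
  by rewrite -[t in LHS]opprK scaleNr fN sf.2 ?oppr_ge0// mulNr opprK.
- exact: le_trans (f_le u) (pe_le u).
- apply/le_anti/andP; split; first exact: le_trans (f_le e) (pe_le e).
  rewrite -lerN2 -fN; apply: (le_trans (f_le _)); apply: (le_trans (pe_e _)).
  by rewrite addNr sublinear0// sub0r.
Qed.

End sublinear.

(** * Seminorms on real or complex vector spaces *)

Definition seminorm (K : numFieldType) (V : lmodType K) (p : V -> K) :=
  [/\ forall u, 0 <= p u, forall u v, p (u + v) <= p u + p v &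
      forall a u, p (a *: u) = `|a| * p u].

Section restriction_of_scalars.
Context {R : realType} (V : lmodType R[i]).

(** A copy of [V], so that the real and the complex scalings do not compete for
the same type. *)
Definition restrict_scalars : Type := V.

HB.instance Definition _ := GRing.Zmodule.on restrict_scalars.

Let scale (r : R) (u : restrict_scalars) : restrict_scalars :=
  real_complex R r *: (u : V).

Let scaleA a b u : scale a (scale b u) = scale (a * b) u.
Proof. by rewrite /scale scalerA rmorphM. Qed.

Let scale1 : left_id 1 scale.
Proof. by move=> u; rewrite /scale rmorph1 scale1r. Qed.

Let scaleDr : right_distributive scale +%R.
Proof. by move=> a u v; rewrite /scale scalerDr. Qed.

Let scaleDl u : {morph scale^~ u : a b / a + b}.
Proof. by move=> a b; rewrite /scale rmorphD scalerDl. Qed.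

HB.instance Definition _ := GRing.Zmodule_isLmodule.Build R restrict_scalars
  scaleA scale1 scaleDr scaleDl.

Lemma restrict_scaleE (r : R) (u : V) :
  r *: (u : restrict_scalars) = real_complex R r *: u.
Proof. by []. Qed.

End restriction_of_scalars.

(** Over the complex numbers, a real functional [f] below the real part of [p] is
the real part of the complex functional [u |-> f u - i * f (i *: u)]. *)
Lemma complex_hahn_banach (R : realType) (V : lmodType R[i]) (p : V -> R[i])
    (e : V) : seminorm p ->
  exists f : V -> R[i]^o,
    [/\ linear f, forall u, `|f u| <= p u & `|f e| = p e].
Proof.
move=> [p0 pD pZ].
have pE u : p u = real_complex R (complex.Re (p u)).
  by rewrite RRe_real//; exact: ger0_real.
pose P (u : restrict_scalars V) : R := complex.Re (p u).
have sP : sublinear P.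
  split=> [u v|t u t0]; first by rewrite -lecR rmorphD /= -!pE; exact: pD.
  apply: complexI; rewrite rmorphM /= -!pE restrict_scaleE pZ.
  by rewrite ger0_norm// ler0c.
have [f [lf fP fe]] := real_hahn_banach (e : restrict_scalars V) sP.
pose i := Complex (0 : R) 1.
pose g (u : V) : R[i]^o := Complex (f u) (- f (i *: u)).
have complex_scale x y (u : V) : Complex x y *: u =
    x *: (u : restrict_scalars V) + y *: (i *: u : restrict_scalars V).
  change (Complex x y *: u =
    real_complex R x *: u + real_complex R y *: (i *: u) :> V).
  rewrite scalerA -scalerDl; congr (_ *: u).
  by apply/eqP; rewrite eq_complex /=; apply/andP; split; apply/eqP; ring.
have fZ a (u : restrict_scalars V) : f (a *: u) = a * f u.
  have f0 : f 0 = 0 by have := lf (-1) 0 0; rewrite scaler0 addr0 scaleN1r addNr.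
  by have := lf a u 0; rewrite f0 !addr0.
have fD u v : f (u + v) = f u + f v.
  by have := lf 1 u v; rewrite !scale1r.
have lg : linear g.
  move=> [x y] u v; rewrite /g scalerDr scalerA (mulrC i) -scalerA.
  rewrite (complex_scale x y u) (complex_scale x y (i *: u)) !fD !fZ.
  have fii : f (i *: (i *: u)) = - f u.
    rewrite -mulN1r -fZ restrict_scaleE rmorphN rmorph1 scalerA.
    congr (f (_ *: u)).
    by apply/eqP; rewrite eq_complex /=; apply/andP; split; apply/eqP; ring.
  rewrite fii; apply/eqP; rewrite eq_complex /=.
  by apply/andP; split; apply/eqP; ring.
have g_le u : `|g u| <= p u.
  have [->|gu0] := eqVneq (g u) 0; first by rewrite normr0.
  (* Rotating [u] by a phase turns the modulus of [g u] into a real part. *)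
  pose a := `|g u| / g u.
  have norm_a : `|a| = 1 by rewrite normrM normfV normr_id divff ?normr_eq0.
  have gau : g (a *: u) = `|g u|.
    have g0 : g 0 = 0.
      by have := lg (-1) 0 0; rewrite scaler0 addr0 scaleN1r addNr.
    by have := lg a u 0; rewrite g0 !addr0 => ->; exact: divfK.
  have -> : p u = p (a *: u) by rewrite pZ norm_a mul1r.
  rewrite -gau pE -[X in X <= _]RRe_real; last by rewrite gau normr_real.
  by rewrite lecR; exact: fP.
exists g; split=> //; apply/le_anti; rewrite g_le pE -[complex.Re _]fe /=.
by apply: le_trans (normc_ge_Re (g e)); rewrite lecR ler_norm.
Qed.

(** With real scalars, [f <= p] is the two-sided bound because [p] is even. *)
Theorem seminorm_hahn_banach (R : realType) (K : numFieldType)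
    (V : lmodType K) (p : V -> K) (e : V) : scalar_field R K -> seminorm p ->
  exists f : V -> K^o,
    [/\ linear f, forall u, `|f u| <= p u & `|f e| = p e].
Proof.
move=> hK; case: K / hK V p e => V p e; last exact: complex_hahn_banach.
move=> [p0 pD pZ].
have [|f [lf fp fe]] := @real_hahn_banach _ _ p e.
  by split=> // t u t0; rewrite pZ ger0_norm.
have fN u : f (- u) = - f u.
  have f0 : f 0 = 0 by have := lf (-1) 0 0; rewrite scaler0 addr0 scaleN1r addNr.
  by have := lf (-1) u 0; rewrite f0 !addr0 !scaleN1r.
exists f; split=> // [u|]; last by rewrite fe ger0_norm.
rewrite ler_norml fp andbT lerNl -fN; apply: (le_trans (fp _)).
by rewrite -scaleN1r pZ normrN1 mul1r.
Qed.

(** * Subspaces and bounded functionals *)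

Section subspaces.
Context {K : numFieldType} {V : lmodType K} (Y : set V).
Hypothesis sY : is_subspace Y.

Lemma subspace0 : Y 0.
Proof. by have [/set_mem] := sY. Qed.

Lemma subspaceDZ a u v : Y u -> Y v -> Y (a *: u + v).
Proof.
by have [_ lY] := sY; move=> Yu Yv; apply/set_mem/lY; exact: mem_set.
Qed.

Lemma subspaceZ a u : Y u -> Y (a *: u).
Proof. by move=> Yu; rewrite -[_ *: _]addr0; exact: subspaceDZ subspace0. Qed.

Lemma subspaceD u v : Y u -> Y v -> Y (u + v).
Proof. by move=> Yu Yv; rewrite -[u]scale1r; exact: subspaceDZ. Qed.

Lemma subspaceB u v : Y u -> Y v -> Y (u - v).
Proof. by move=> Yu Yv; rewrite addrC -scaleN1r; exact: subspaceDZ. Qed.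

End subspaces.

Lemma is_subspaceP (K : numFieldType) (V : lmodType K) (Y : set V) :
  Y 0 -> (forall a u v, Y u -> Y v -> Y (a *: u + v)) -> is_subspace Y.
Proof.
move=> Y0 YDZ; split; first exact: mem_set.
by move=> a u v /set_mem Yu /set_mem Yv; apply/mem_set; exact: YDZ.
Qed.

Section dual_functionals.
Context {K : numFieldType} {E : normedModType K}.
Implicit Types (f g : dual E) (x : E) (X : set E).

Lemma dual_linear f : linear f.
Proof. by have /asboolP[] := dual_valP f. Qed.

HB.instance Definition _ f :=
  GRing.isLinear.Build K E K^o *:%R (dual_val f) (dual_linear f).

Lemma dual_continuous f : continuous f.
Proof. by have /asboolP[] := dual_valP f. Qed.

Lemma dual_bounded f : exists2 C : K, 0 < C & forall x, `|f x| <= C * `|x|.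
Proof.
have /linear_bounded_continuous/linear_boundedP := @dual_continuous f.
by move=> /pinfty_ex_gt0[C C0 fC]; exists C.
Qed.

Lemma bounded_functional (f : E -> K^o) (C : K) :
  0 <= C -> linear f -> (forall x, `|f x| <= C * `|x|) ->
  exists g : dual E, forall x, g x = f x.
Proof.
move=> C0 lf fC.
pose F : {linear E -> K^o} := HB.pack f (GRing.isLinear.Build _ _ _ _ _ lf).
have cF : continuous (F : E -> K^o).
  apply/linear_bounded_continuous/ex_bound; exists C.
  apply/nbhs_norm0P; exists 1 => //= x /= x1.
  by apply: (le_trans (fC x)); rewrite ler_piMr// ltW.
by exists (@Dual _ _ f (asboolT (conj lf cF))).
Qed.

(** The norm of the restriction of [f] to [X]; [dual_norm] is the case
[X = setT]. *)
Definition restricted_norm X f : K := supremum 0 [set `|f x| | x in unit_ball X].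

Context (R : realType) (hK : scalar_field R K).

Lemma restricted_normP X f : is_subspace X ->
  isLub [set `|f x| | x in unit_ball X] (restricted_norm X f).
Proof.
move=> sX; have [C C0 fC] := dual_bounded f.
apply: (@supremum_isLub _ _ _ C hK).
  by exists (`|f 0|), 0 => //; split; [exact: subspace0|rewrite normr0].
move=> _ [x [_ x1] <-]; rewrite normr_ge0/=.
by apply: le_trans (fC x) _; rewrite ler_piMr// ltW.
Qed.

Lemma restricted_norm_ge0 X f : is_subspace X -> 0 <= restricted_norm X f.
Proof.
move=> sX; apply: (le_trans (normr_ge0 (f 0))).
apply: (restricted_normP f sX).1; exists 0 => //.
by split; [exact: subspace0|rewrite normr0].
Qed.

Lemma le_restricted_norm X f x : is_subspace X -> X x ->
  `|f x| <= restricted_norm X f * `|x|.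
Proof.
move=> sX Xx; have [->|x0] := eqVneq x 0.
  by rewrite linear0 !normr0 mulr0.
have nx0 : 0 < `|x| by rewrite normr_gt0.
have : `|f (`|x|^-1 *: x)| <= restricted_norm X f.
  apply: (restricted_normP f sX).1; exists (`|x|^-1 *: x) => //.
  split; first exact: subspaceZ.
  by rewrite normrZ normfV normr_id mulVf ?gt_eqF.
by rewrite linearZ /= normrM normfV normr_id ler_pdivrMl// mulrC.
Qed.

Lemma restricted_norm_le X f C : is_subspace X -> 0 <= C ->
  (forall x, X x -> `|f x| <= C * `|x|) -> restricted_norm X f <= C.
Proof.
move=> sX C0 fC; apply: (restricted_normP f sX).2 => _ [x [Xx x1] <-].
by apply: (le_trans (fC x Xx)); rewrite ler_piMr.
Qed.

Lemma setT_subspace : is_subspace [set: E].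
Proof. exact: is_subspaceP. Qed.

Lemma le_dual_norm f x : `|f x| <= dual_norm f * `|x|.
Proof. exact: (le_restricted_norm f setT_subspace). Qed.

Lemma dual_norm_ge0 f : 0 <= dual_norm f.
Proof. exact: restricted_norm_ge0 setT_subspace. Qed.

Lemma dual_norm_le f C : 0 <= C -> (forall x, `|f x| <= C * `|x|) ->
  dual_norm f <= C.
Proof.
by move=> C0 fC; apply: (restricted_norm_le setT_subspace) => // x _.
Qed.

Lemma preannihilator_subspace (Z : set (dual E)) :
  is_subspace (preannihilator Z).
Proof.
apply: is_subspaceP => [f _|a u v Zu Zv f Zf]; first exact: linear0.
by rewrite linearP /= (Zu f Zf) (Zv f Zf) scaler0 addr0.
Qed.

Lemma preannihilator_closed (Z : set (dual E)) : closed (preannihilator Z).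
Proof.
have -> : preannihilator Z = \bigcap_(f in Z) (f @^-1` [set 0]) by [].
apply: closed_bigI => f _; apply: closed_comp => [x _|].
  exact: dual_continuous.
exact: accessible_closed_set1 (hausdorff_accessible (@norm_hausdorff K K^o)) _.
Qed.

End dual_functionals.

(** * The cost of approximating a vector by a sum *)

Section approximation.
Context {R : realType} {K : numFieldType} (hK : scalar_field R K).
Context {E : normedModType K} (X Y : set E) (a : K).
Hypotheses (sX : is_subspace X) (sY : is_subspace Y) (a0 : 0 <= a).

Let lower_bounds (v : E) : set K :=
  [set t | 0 <= t /\ forall x y, X x -> Y y -> t <= a * `|x| + `|v - x - y|].

(** The infimum of [a * `|x| + `|v - x - y|] over [x] in [X] and [y] in [Y],
written as the supremum of its lower bounds so that [supremum_isLub] applies.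
It is the largest seminorm below the norm
that vanishes on [Y] and is at most [a] times the norm on [X]. *)
Definition sum_cost (v : E) : K := supremum 0 (lower_bounds v).

Let lower_bounds0 v : lower_bounds v 0.
Proof. by split=> // x y _ _; rewrite addr_ge0 ?mulr_ge0. Qed.

Let sum_costP v : isLub (lower_bounds v) (sum_cost v).
Proof.
apply: (@supremum_isLub _ _ _ `|v| hK); first by exists 0.
move=> t [t0 tv]; rewrite t0/=; have := tv _ _ (subspace0 sX) (subspace0 sY).
by rewrite normr0 mulr0 add0r !subr0.
Qed.

Lemma sum_cost_le v x y : X x -> Y y -> sum_cost v <= a * `|x| + `|v - x - y|.
Proof. by move=> Xx Yy; apply: (sum_costP v).2 => t [_]; apply. Qed.

(** The triangle inequality applies this to a difference [t], of either sign. *)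
Lemma le_sum_cost v t : t \is Num.real ->
  (forall x y, X x -> Y y -> t <= a * `|x| + `|v - x - y|) -> t <= sum_cost v.
Proof.
move=> tR tv; have [t0|/ltW t0] := real_leP (real0 K) tR.
  by apply: (sum_costP v).1.
by apply: (le_trans t0); apply: (sum_costP v).1.
Qed.

Lemma sum_cost_ge0 v : 0 <= sum_cost v.
Proof. exact: (sum_costP v).1. Qed.

Lemma sum_cost_seminorm : seminorm sum_cost.
Proof.
have real_cost x v y : a * `|x| + `|v - x - y| \is Num.real.
  by rewrite ger0_real// addr_ge0 ?mulr_ge0.
have leZ c v : c != 0 -> `|c| * sum_cost v <= sum_cost (c *: v).
  move=> c0; apply: le_sum_cost => [|x y Xx Yy].
    by rewrite ger0_real// mulr_ge0// sum_cost_ge0.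
  have := @sum_cost_le v _ _ (subspaceZ sX c^-1 Xx) (subspaceZ sY c^-1 Yy).
  rewrite -(ler_pM2l (_ : 0 < `|c|)) ?normr_gt0// => /le_trans; apply.
  rewrite mulrDr mulrCA -!normrZ !scalerBr !scalerA mulfV// !scale1r.
  exact: lexx.
split=> [v|u v|c v]; first exact: sum_cost_ge0.
- have uvR : sum_cost (u + v) - sum_cost v \is Num.real.
    by rewrite realB// ger0_real// sum_cost_ge0.
  rewrite -lerBlDr; apply: le_sum_cost => // x y Xx Yy.
  rewrite lerBlDr -lerBlDl; apply: le_sum_cost => [|x' y' Xx' Yy'].
    by rewrite realB// ger0_real// sum_cost_ge0.
  rewrite lerBlDl; apply: (le_trans (sum_cost_le (u + v)
    (subspaceD sX Xx Xx') (subspaceD sY Yy Yy'))).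
  rewrite addrACA -mulrDr lerD ?ler_wpM2l ?ler_normD//.
  rewrite [X in `|X|](_ : _ = (u - x - y) + (v - x' - y')) ?ler_normD//.
  by rewrite !opprD [RHS]addrACA (addrACA u).
- have [->|c0] := eqVneq c 0.
    rewrite scale0r normr0 mul0r; apply/le_anti; rewrite sum_cost_ge0 andbT.
    have := sum_cost_le 0 (subspace0 sX) (subspace0 sY).
    by rewrite !subr0 normr0 mulr0 addr0.
  apply/le_anti; rewrite leZ// andbT -ler_pdivrMl ?normr_gt0//.
  rewrite -normfV -[X in _ <= sum_cost X](scalerK c0).
  by apply: leZ; rewrite invr_eq0.
Qed.

Lemma sum_cost_functional (e : E) :
  exists f : dual E, [/\ forall y, Y y -> f y = 0,
    forall x, X x -> `|f x| <= a * `|x|,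
    forall v, `|f v| <= `|v| & `|f e| = sum_cost e].
Proof.
have [f [lf f_le fe]] := seminorm_hahn_banach e hK sum_cost_seminorm.
have f_le1 v : `|f v| <= 1 * `|v|.
  rewrite mul1r; apply: (le_trans (f_le v)).
  have := sum_cost_le v (subspace0 sX) (subspace0 sY).
  by rewrite normr0 mulr0 add0r !subr0.
have [g gE] := bounded_functional ler01 lf f_le1.
exists g; split=> [y Yy|x Xx|v|]; rewrite gE.
- apply/eqP; rewrite -normr_le0; apply: (le_trans (f_le y)).
  have := sum_cost_le y (subspace0 sX) Yy.
  by rewrite normr0 mulr0 add0r subr0 subrr normr0.
- apply: (le_trans (f_le x)).
  have := sum_cost_le x Xx (subspace0 sY).
  by rewrite subr0 subrr normr0 addr0.
- by rewrite -[leRHS]mul1r.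
- exact: fe.
Qed.

(** The dual description of approximability: what bounds the values at [e] of the
functionals below the cost also bounds the cost of [e], since one of them
attains it.  With [a = 0] the sum [X + Y] is shown to come close to [e]; with
[a > 0] the size of the summand in [X] is controlled as well. *)
Lemma approximate_sum (e : E) (t : K) : 0 <= t ->
  (forall f : dual E, (forall y, Y y -> f y = 0) ->
     (forall x, X x -> `|f x| <= a * `|x|) -> `|f e| < t) ->
  exists x y, [/\ X x, Y y & a * `|x| + `|e - x - y| < t].
Proof.
move=> t0 small; have [f [fY fX _ fe]] := sum_cost_functional e.
have := small f fY fX; rewrite fe => et; apply: contrapT => no_xy.
suff : t <= sum_cost e by move=> /(lt_le_trans et); rewrite ltxx.
apply: le_sum_cost => [|x y Xx Yy]; first exact: ger0_real.
rewrite ge0_leNgt ?addr_ge0 ?mulr_ge0//.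
by apply/negP => xyt; apply: no_xy; exists x, y.
Qed.

End approximation.

(** * Sums of closed subspaces of a Banach space *)

Section completeness.
Context {R : realType} {K : numFieldType} (hK : scalar_field R K).
Context {E : completeNormedModType K}.
Implicit Types (X Y : set E) (u v : nat -> E).

(** The sum of the steps from [n] on is at most [2 * r n]; this is both the Cauchy
property and the estimate for the limit. *)
Lemma geometric_steps_cvg u (r : nat -> K) :
  (forall n, r n.+1 <= r n / 2) -> (forall n, `|u n.+1 - u n| <= r n) ->
  exists2 l, u @ \oo --> l & forall n, `|l - u n| <= 2 * r n.
Proof.
move=> r_half u_r.
have r0 n : 0 <= r n := le_trans (normr_ge0 _) (u_r n).
(* The second summand makes room for the steps that follow. *)
have dist n k : `|u (n + k)%N - u n| + 2 * r (n + k)%N <= 2 * r n.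
  elim: k => [|k]; first by rewrite addn0 subrr normr0 add0r.
  apply: le_trans; rewrite addnS -(subrKA (u (n + k)%N)).
  have := lerD (ler_normD (u (n + k).+1 - u (n + k)%N) (u (n + k)%N - u n))
    (ler_wpM2l (ler0n _ 2) (r_half (n + k)%N)).
  move=> /le_trans; apply.
  rewrite [2 * (_ / 2)]mulrC divfK ?pnatr_eq0// addrAC addrC lerD2l.
  by rewrite mulrDl mul1r lerD2r.
have {}dist n m : (n <= m)%N -> `|u m - u n| <= 2 * r n.
  move=> /subnKC <-; apply: le_trans (dist n (m - n)%N).
  by rewrite lerDl mulr_ge0.
have r_le n : r n <= r 0%N / 2 ^+ n.
  elim: n => [|n ih]; first by rewrite expr0 divr1.
  apply: (le_trans (r_half n)).
  by rewrite exprSr invfM mulrA ler_pM2r// invr_gt0.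
have r_small e : 0 < e -> exists n, 2 * r n < e.
  move=> e0; have [n rn] := exists_half_pow_lt hK (mulr_ge0 (ler0n _ 2) (r0 0%N)) e0.
  by exists n; apply: le_lt_trans rn; rewrite -mulrA ler_pM2l.
have /cauchy_cvgP/cvg_ex[l ul] : cauchy (u @ \oo).
  apply: cauchy_exP => e /r_small[n rn]; exists (u n); exists n => // m /= nm.
  by rewrite -ball_normE /ball_ /= distrC; apply: le_lt_trans rn; exact: dist.
exists l => // n.
rewrite ge0_leNgt ?mulr_ge0//.
apply/negP; rewrite -subr_gt0 => e0.
have [N _ lN] : \forall m \near \oo, `|l - u m| < `|l - u n| - 2 * r n.
  by move/cvgrPdist_lt : ul; apply.
have := lN (maxn n N) (leq_maxr n N); rewrite ltrBrDl => /=.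
apply/negP; rewrite -ge0_leNgt ?addr_ge0 ?mulr_ge0//.
apply: (le_trans (ler_distD (u (maxn n N)) _ _)).
by rewrite [leRHS]addrC lerD2l; apply: dist; exact: leq_maxl.
Qed.

(** Subtracting approximations repeatedly halves the remainder, so the summands
in [X] and those in [Y] form convergent series.  This is the final half of
the proof of the open mapping theorem, for the addition map of [X] and [Y]. *)
Lemma sum_of_half_approximation X Y (M : K) :
  is_subspace X -> closed X -> is_subspace Y -> closed Y -> 0 <= M ->
  (forall e, exists x y, [/\ X x, Y y, `|x| <= M * `|e| &
     `|e - x - y| <= `|e| / 2]) ->
  forall e, exists x y, [/\ X x, Y y, e = x + y & `|x| <= 2 * M * `|e|].
Proof.
move=> sX cX sY cY M0 half e.
have [a /choice[b ab]] := choice half.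
pose res n := iter n (fun e => e - a e - b e) e.
pose u n := \sum_(k < n) a (res k).
pose v n := \sum_(k < n) b (res k).
have Xu n : X (u n).
  rewrite /u; elim/big_ind: _ => [|x y|k _]; first exact: subspace0.
    exact: subspaceD.
  by have [] := ab (res k).
have Yv n : Y (v n).
  rewrite /v; elim/big_ind: _ => [|x y|k _]; first exact: subspace0.
    exact: subspaceD.
  by have [] := ab (res k).
have res_le n : `|res n| <= `|e| / 2 ^+ n.
  elim: n => [|n ih]; first by rewrite expr0 divr1.
  have [_ _ _ /le_trans] := ab (res n); apply.
  by rewrite exprSr invfM mulrA ler_pM2r// invr_gt0.
have res_cvg : res @ \oo --> 0.
  apply/cvgr0Pnorm_lt => eps eps0.
  have [n en] := exists_half_pow_lt hK (normr_ge0 e) eps0.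
  exists n => // m /= nm; apply: (le_lt_trans (res_le m)); apply: le_lt_trans en.
  by rewrite ler_wpM2l// lef_pV2 ?posrE ?exprn_gt0// ler_weXn2l// ler1n.
have uvE n : e = u n + v n + res n.
  elim: n => [|n ih]; first by rewrite /u /v !big_ord0 !add0r.
  have -> : u n.+1 = u n + a (res n) by rewrite /u big_ord_recr.
  have -> : v n.+1 = v n + b (res n) by rewrite /v big_ord_recr.
  have -> : res n.+1 = res n - a (res n) - b (res n) by [].
  rewrite {1}ih (addrACA (u n)) -[RHS]addrA; congr (_ + _).
  by rewrite [RHS]addrC -(addrA (res n)) -opprD subrK.
have [||l ul l_le] := @geometric_steps_cvg u (fun n => M * (`|e| / 2 ^+ n)).
- by move=> n; rewrite exprSr invfM !mulrA.
- move=> n; rewrite /u big_ord_recr /= addrAC subrr add0r.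
  by have [_ _ /le_trans ale _] := ab (res n); apply: ale; rewrite ler_wpM2l.
exists l, (e - l); split.
- by apply: closed_cvg ul => //; exact: nearW.
- have vl : v @ \oo --> e - l.
    have -> : v = (fun n => e - u n - res n).
      by apply/funext => n; rewrite {1}(uvE n) addrAC addrK addrAC subrr add0r.
    rewrite -[X in _ --> X]subr0; apply: cvgB => //.
    by apply: cvgB => //; exact: cvg_cst.
  by apply: closed_cvg vl => //; exact: nearW.
- by rewrite addrC subrK.
- by have := l_le 0%N; rewrite /u big_ord0 subr0 expr0 divr1 mulrA.
Qed.

(** The Baire category half of the open mapping theorem.  The space is the union
of the sets of sums [x + y] with [`|x| <= 2 ^+ n].  If one of them is dense in
some ball, differences of its elements approximate all small vectors.
Otherwise nested balls avoiding these sets one after the other shrink to a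
point which is no sum at all. *)
Lemma half_approximation_of_sum X Y : is_subspace X -> is_subspace Y ->
  (forall e, exists x y, [/\ X x, Y y & e = x + y]) ->
  exists2 M : K, 0 <= M & forall e, exists x y,
    [/\ X x, Y y, `|x| <= M * `|e| & `|e - x - y| <= `|e| / 2].
Proof.
move=> sX sY XYT.
pose dense_in (n : nat) (c : E) (rho : K) :=
  forall w : E, `|w - c| <= rho -> forall eps, 0 < eps ->
  exists x y, [/\ X x, Y y, `|x| <= 2 ^+ n & `|w - x - y| < eps].
have [[n [c [rho [rho0 Pn]]]]|nowhere] :=
    pselect (exists n c (rho : K), 0 < rho /\ dense_in n c rho).
  exists (2 * 2 ^+ n / rho) => [|e].
    by rewrite divr_ge0 ?mulr_ge0 ?exprn_ge0// ltW.
  have [->|e0] := eqVneq e 0.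
    exists 0, 0; split; [exact: subspace0|exact: subspace0| |].
      by rewrite !normr0 mulr0.
    by rewrite !subr0 normr0 mul0r.
  have ne0 : 0 < `|e| by rewrite normr_gt0.
  (* Scaling [e] by [s] brings it to the size of the ball. *)
  pose s := rho / `|e|; have s0 : 0 < s by exact: divr_gt0.
  have eps0 : 0 < s * (`|e| / 2) / 2 by rewrite !(divr_gt0, mulr_gt0).
  have [|x1 [y1 [Xx1 Yy1 x1n v1]]] := Pn (c + s *: e) _ _ eps0.
    by rewrite addrAC subrr add0r normrZ gtr0_norm// divfK ?gt_eqF.
  have [|x2 [y2 [Xx2 Yy2 x2n v2]]] := Pn c _ _ eps0.
    by rewrite subrr normr0 ltW.
  have sV : `|s^-1| = s^-1 by rewrite gtr0_norm ?invr_gt0.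
  exists (s^-1 *: (x1 - x2)), (s^-1 *: (y1 - y2)); split.
  - by apply: subspaceZ => //; exact: subspaceB.
  - by apply: subspaceZ => //; exact: subspaceB.
  - rewrite normrZ sV ler_pdivrMl//.
    have -> : s * (2 * 2 ^+ n / rho * `|e|) = 2 ^+ n + 2 ^+ n.
      by rewrite /s; field; rewrite normr_eq0 e0 gt_eqF.
    by apply: (le_trans (ler_normB _ _)); exact: lerD.
  - rewrite -[X in `|X - _ - _|](scalerK (lt0r_neq0 s0)) -!scalerBr normrZ sV.
    rewrite ler_pdivrMl//.
    have -> : s *: e - (x1 - x2) - (y1 - y2) =
        (c + s *: e - x1 - y1) - (c - x2 - y2).
      rewrite !opprD !opprK [RHS]addrACA (addrACA (c + s *: e)).
      by rewrite (addrAC c) subrr add0r.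
    apply: (le_trans (ler_normB _ _)).
    by rewrite [leRHS]splitr; exact: lerD (ltW v1) (ltW v2).
(* The pair [w] is a center and a radius.  The centers move by at most the
   radius at each step and the radii at least halve, so the limit is at distance
   at most [2 * w.2] from [w.1], hence outside the set of index [z.1]. *)
have step (z : nat * (E * K)) : exists w : E * K, 0 < z.2.2 ->
    [/\ `|w.1 - z.2.1| <= z.2.2, 0 < w.2, w.2 <= z.2.2 / 2 &
      forall x y, X x -> Y y -> `|x| <= 2 ^+ z.1 -> 2 * w.2 < `|w.1 - x - y|].
  case: z => n [c r] /=.
  have [r0|_] := boolP (0 < r); last by exists (0, 0).
  have /existsNP[v /not_implyP[vc /existsNP[eps /not_implyP[eps0 far]]]] :
      ~ dense_in n c r.
    by move=> Pn; apply: nowhere; exists n, c, r.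
  have [k rk] := exists_half_pow_lt hK (ltW r0) eps0.
  exists (v, r / 2 ^+ k.+1); split=> //= [||x y Xx Yy xn].
  - by rewrite divr_gt0 ?exprn_gt0.
  - rewrite ler_pM2l// lef_pV2 ?posrE ?exprn_gt0//.
    by rewrite -[X in X <= _]expr1 ler_weXn2l// ler1n.
  - have -> : 2 * (r / 2 ^+ k.+1) = r / 2 ^+ k.
      by rewrite exprSr invfM (mulrA r) [LHS]mulrC divfK ?pnatr_eq0.
    apply: (lt_le_trans rk).
    rewrite ge0_leNgt ?(ltW eps0)//.
    by apply/negP => vxy; apply: far; exists x, y.
have [next next_step] := choice step.
pose z n := iteri n (fun k => next \o pair k) (0, 1).
have r0 n : 0 < (z n).2.
  elim: n => [|n ih]; first exact: ltr01.
  by have [] := next_step (n, z n) ih.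
have [||l _ l_le] := @geometric_steps_cvg (fst \o z) (snd \o z).
- by move=> n; have [] := next_step (n, z n) (r0 n).
- by move=> n; have [] := next_step (n, z n) (r0 n).
have [x [y [Xx Yy lxy]]] := XYT l.
have [n xn] := exists_half_pow_lt hK (normr_ge0 x) ltr01.
have [_ _ _ /(_ x y Xx Yy)] := next_step (n, z n) (r0 n).
rewrite ltr_pdivrMr ?exprn_gt0// mul1r in xn.
move=> /(_ (ltW xn)) /= far.
have := le_lt_trans (l_le n.+1) far.
by rewrite lxy /= distrC opprD addrA ltxx.
Qed.

End completeness.

(** * Weak-star closed subspaces are annihilators *)

Section bipolar.
Context {K : numFieldType} {E : normedModType K}.
Implicit Types (Z : set (dual E)) (f g : dual E).

Lemma dualD f g (x : E) : (f + g) x = f x + g x. Proof. by []. Qed.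
Lemma dualZ (a : K) f (x : E) : (a *: f) x = a * f x. Proof. by []. Qed.
Lemma dualB f g (x : E) : (f - g) x = f x - g x. Proof. by []. Qed.

Lemma dual_subZ f (a : K) (x y : E) : f (y - a *: x) = f y - a * f x.
Proof. by rewrite linearB linearZ. Qed.

(** On finitely many points [Z] is as rich as its bipolar.  At a point [x] where
some [g0] in [Z] takes the value 1, the part of [f] along [g0] is removed and
[Z] is replaced by its functionals vanishing at [x]; the corrected functional
still vanishes on the larger preannihilator, because [y - g0 y *: x] is killed
by [Z] whenever [y] is killed by that part of [Z]. *)
Lemma interpolation_in_bipolar Z f (s : seq E) : is_subspace Z ->
  (forall x, preannihilator Z x -> f x = 0) ->
  exists2 g, Z g & {in s, forall x, g x = f x}.
Proof.
elim: s Z f => [|x s ih] Z f sZ fZ.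
  by exists 0 => //; exact: subspace0.
have [Zx|/existsNP[g1 /not_implyP[Zg1 g1x]]] := pselect (preannihilator Z x).
  have [g Zg gs] := ih Z f sZ fZ.
  exists g => // y; rewrite inE => /predU1P[->|/gs//].
  by rewrite (Zx g Zg) fZ.
have {}g1x : g1 x != 0 by apply/eqP.
pose g0 := (g1 x)^-1 *: g1.
have Zg0 : Z g0 by exact: subspaceZ.
have g0x : g0 x = 1 by rewrite dualZ mulVf.
pose Z' := Z `&` [set g | g x = 0].
have sZ' : is_subspace Z'.
  apply: is_subspaceP => [|a g h [Zg gx] [Zh hx]].
    by split; first exact: subspace0.
  split; first exact: subspaceDZ.
  by change (a * g x + h x = 0); rewrite gx hx mulr0 addr0.
have [y Z'y|g [Zg gx] gs] := ih Z' (f - f x *: g0) sZ'.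
  have : preannihilator Z (y - g0 y *: x).
    move=> g Zg; have hg : (g - g x *: g0) y = 0.
      apply: Z'y; split; first by apply: subspaceB => //; exact: subspaceZ.
      by change (g x - g x * g0 x = 0); rewrite g0x mulr1 subrr.
    by rewrite dual_subZ mulrC -hg.
  by move=> /fZ; rewrite dual_subZ mulrC.
exists (g + f x *: g0); first by apply: subspaceD => //; exact: subspaceZ.
move=> y; rewrite inE dualD dualZ => /predU1P[->|/gs ->].
  by rewrite gx g0x mulr1 add0r.
by rewrite dualB dualZ subrK.
Qed.

(** Functionals agreeing with [f] on a finite set lie in every basic weak-star
neighbourhood of [f] given by evaluations at its points. *)
Lemma weak_star_closure Z f :
  (forall s : seq E, exists2 g, Z g & {in s, forall x, g x = f x}) ->
  closed (Z : set (weak_star E)) -> Z f.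
Proof.
move=> Zf; apply.
pose agree (s : seq E) := [set g : dual E | Z g /\ {in s, forall x, g x = f x}].
pose F : set_system (dual E) := filter_from setT agree.
have FF : Filter F.
  apply: filter_from_filter; first by exists [::].
  move=> s t _ _; exists (s ++ t) => // g [Zg gst].
  by split; split=> // x xs; apply: gst; rewrite mem_cat xs ?orbT.
have Ff : F --> (f : weak_star E).
  apply/cvg_sup => x A; rewrite nbhsE => -[_ [[U _ <-] Uf] UA].
  exists [:: x] => // g [_ gx]; apply: UA => /=.
  by rewrite gx ?mem_head.
move=> A /Ff[s _ sA]; have [g Zg gs] := Zf s.
by exists g; split=> //; exact: sA.
Qed.

Lemma weak_star_closed_bipolar Z f : is_subspace Z ->
  closed (Z : set (weak_star E)) ->
  (forall x, preannihilator Z x -> f x = 0) -> Z f.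
Proof.
move=> sZ cZ fZ; apply: weak_star_closure cZ => s.
exact: interpolation_in_bipolar.
Qed.

End bipolar.

(** * Norming subspaces and direct sums *)

Section equivalences.
Context {R : realType} {K : numFieldType} (hK : scalar_field R K).

(** Both kinds of norming are suprema of a family of functionals dominated by the
given norm, so only the lower bound is at stake. *)
Lemma sup_norm_equivalent (V : lmodType K) (Y : set V) (N0 : V -> K)
    (I : Type) (D : set I) (phi : I -> V -> K^o) (c : K) :
  D !=set0 -> (forall i, linear (phi i)) ->
  (forall i y, D i -> Y y -> `|phi i y| <= N0 y) ->
  (forall y, Y y -> N0 y = 0 -> y = 0) ->
  0 < c ->
  (forall y, Y y -> c * N0 y <= supremum 0 [set `|phi i y| | i in D]) ->
  equivalent_norm_on Y N0 (fun y => supremum 0 [set `|phi i y| | i in D]).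
Proof.
move=> [i0 Di0] lphi phi_le N0_eq0 c0 lower.
set N := fun y => _.
have NP y b : (forall i, D i -> `|phi i y| <= b) ->
    isLub [set `|phi i y| | i in D] (N y).
  move=> yb; apply: (@supremum_isLub _ _ _ b hK); first by exists `|phi i0 y|, i0.
  by move=> _ [i Di <-]; rewrite normr_ge0 yb.
have NY y : Y y -> isLub [set `|phi i y| | i in D] (N y).
  by move=> Yy; apply: (NP y (N0 y)) => i Di; exact: phi_le.
have phi_N y i : Y y -> D i -> `|phi i y| <= N y.
  by move=> Yy Di; apply: (NY y Yy).1; exists i.
have N_ge0 y : Y y -> 0 <= N y.
  by move=> Yy; apply: le_trans (phi_N _ _ Yy Di0).
have N0_ge0 y : Y y -> 0 <= N0 y.
  by move=> Yy; apply: le_trans (phi_le _ _ Di0 Yy).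
have phi0 i : phi i 0 = 0.
  by have := lphi i (-1) 0 0; rewrite scaler0 addr0 scaleN1r addNr.
have phiZ i a y : `|phi i (a *: y)| = `|a| * `|phi i y|.
  by have := lphi i a y 0; rewrite phi0 !addr0 => ->; rewrite normrM.
split; last first.
  exists c, 1; split=> // y Yy; rewrite lower//= mul1r.
  by apply: (NY y Yy).2 => _ [i Di <-]; exact: phi_le.
split=> //.
- move=> y Yy Ny0; apply: N0_eq0 => //; apply/le_anti; rewrite N0_ge0// andbT.
  by rewrite -(ler_pM2l c0) mulr0 -Ny0; exact: lower.
- move=> a y Yy; have aNP : isLub [set `|phi i (a *: y)| | i in D] (N (a *: y)).
    by apply: (NP _ (`|a| * N y)) => i Di; rewrite phiZ ler_wpM2l ?phi_N.
  apply/le_anti/andP; split.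
    by apply: aNP.2 => _ [i Di <-]; rewrite phiZ ler_wpM2l ?phi_N.
  have [a0|a0] := eqVneq a 0.
    rewrite {1}a0 normr0 mul0r; apply: (le_trans (normr_ge0 (phi i0 (a *: y)))).
    by apply: aNP.1; exists i0.
  rewrite -ler_pdivlMl ?normr_gt0//; apply: (NY y Yy).2 => _ [i Di <-].
  by rewrite ler_pdivlMl ?normr_gt0// -phiZ; apply: aNP.1; exists i.
- move=> y z Yy Yz.
  have yz i : D i -> `|phi i (y + z)| <= N y + N z.
    move=> Di; have := lphi i 1 y z; rewrite !scale1r => ->.
    by apply: (le_trans (ler_normD _ _)); rewrite lerD ?phi_N.
  by apply: (NP _ _ yz).2 => _ [i Di <-]; exact: yz.
Qed.

Context {E : completeNormedModType K} (X : set E) (Z : set (dual E)).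
Hypotheses (sX : is_subspace X) (sZ : is_subspace Z).

Let N (x : E) : K := supremum 0 [set `|f x| | f in dual_unit_ball Z].

Lemma dual_unit_ball0 : dual_unit_ball Z 0.
Proof.
split; first exact: subspace0.
apply: (dual_norm_le hK ler01) => x.
by change (`|0 : K| <= 1 * `|x|); rewrite normr0 mul1r.
Qed.

Lemma le_dual_unit_ball (f : dual E) x : dual_unit_ball Z f -> `|f x| <= `|x|.
Proof.
move=> [_ f1]; apply: (le_trans (le_dual_norm hK f x)).
by rewrite ler_piMl.
Qed.

Lemma dual_unit_ball_normP x : isLub [set `|f x| | f in dual_unit_ball Z] (N x).
Proof.
apply: (@supremum_isLub _ _ _ `|x| hK).
  by exists `|(0 : dual E) x|, 0 => //; exact: dual_unit_ball0.
by move=> _ [f Zf <-]; rewrite normr_ge0 le_dual_unit_ball.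
Qed.

Lemma norming_total : norming_for Z X -> total_over Z X.
Proof.
move=> [[_ N_eq0 _ _] _]; apply/seteqP; split=> [x [Xx Zx]|_ ->].
  apply: N_eq0 => //; apply/le_anti/andP; split.
    by apply: (dual_unit_ball_normP x).2 => _ [f [Zf _] <-]; rewrite Zx// normr0.
  apply: (le_trans (normr_ge0 ((0 : dual E) x))).
  apply: (dual_unit_ball_normP x).1; exists 0 => //; exact: dual_unit_ball0.
by split; [exact: subspace0|exact: subspace0 (preannihilator_subspace Z)].
Qed.

Lemma conorming_cototal : conorming_for X Z -> cototal_over X Z.
Proof.
move=> [[_ N_eq0 _ _] _]; apply/seteqP; split=> [f [fX Zf]|_ ->].
  apply: N_eq0 => //; apply/le_anti/andP; split.
    by apply: (restricted_normP hK f sX).2 => _ [x [Xx _] <-]; rewrite fX// normr0.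
  exact: (restricted_norm_ge0 hK f sX).
by split; [|exact: subspace0].
Qed.

Hypotheses (cX : closed X) (cZ : closed (Z : set (weak_star E))).

Let Y := preannihilator Z.
Let sY : is_subspace Y := preannihilator_subspace Z.

Lemma direct_sum_of_half_approximation (M : K) : total_over Z X -> 0 <= M ->
  (forall e, exists x y, [/\ X x, Y y, `|x| <= M * `|e| &
     `|e - x - y| <= `|e| / 2]) -> direct_sum X Y.
Proof.
move=> XY0 M0 half; split; first exact: XY0.
apply/seteqP; split=> // e _.
have [x [y [Xx Yy -> _]]] := sum_of_half_approximation hK sX cX sY
  (@preannihilator_closed _ _ Z) M0 half e.
by exists x => //; exists y.
Qed.

(** A functional vanishing on [X] and on [Y] lies in [Z] by the bipolar property,
hence is zero by totality: [X + Y] is dense.  The elements of the unit ball of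
[Z] do not see [y], so norming bounds [x] by [x + y] and dense approximations
come with bounded summands. *)
Lemma norming_cototal_direct_sum :
  norming_for Z X -> cototal_over X Z -> direct_sum X Y.
Proof.
move=> ZX XZ; have [_ [c [C [c0 _ ZXc]]]] := ZX.
apply: (@direct_sum_of_half_approximation (c^-1 * (1 + 2^-1))).
- exact: norming_total.
- by rewrite mulr_ge0 ?invr_ge0 ?addr_ge0 ?ltW.
move=> e; have [->|e0] := eqVneq e 0.
  exists 0, 0; rewrite !subr0 normr0 mulr0 mul0r.
  by split=> //; exact: subspace0.
have ne0 : 0 < `|e| by rewrite normr_gt0.
have [||x [y [Xx Yy]]] := approximate_sum hK sX sY (lexx 0) (e := e) (t := `|e| / 2).
- by rewrite divr_ge0.
- move=> f fY fX; have : (annihilator X `&` Z) f.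
    split; first by move=> x /fX; rewrite mul0r normr_le0 => /eqP.
    exact: weak_star_closed_bipolar.
  rewrite XZ => ->; change (`|0 : K| < `|e| / 2).
  by rewrite normr0 divr_gt0.
rewrite mul0r add0r => /ltW exy; exists x, y; split=> //.
rewrite -mulrA ler_pdivlMl//.
have /andP[/le_trans cx _] := ZXc x Xx; apply: cx.
apply: (dual_unit_ball_normP x).2 => _ [f Zf <-].
have -> : f x = f (x + y) by rewrite linearD /= [f y]Yy ?addr0//; case: Zf.
apply: (le_trans (le_dual_unit_ball _ Zf)).
rewrite mulrDl mul1r [2^-1 * _]mulrC.
have -> : x + y = e - (e - x - y) by rewrite -addrA -opprD opprB [RHS]addrC subrK.
by apply: (le_trans (ler_normB _ _)); rewrite lerD2l.
Qed.

(** A functional vanishing on [Y] lies in [Z], where its norm is controlled by its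
norm on [X]: the map from [X] to the quotient by [Y] has an adjoint that is
bounded below, hence is onto. *)
Lemma conorming_total_direct_sum :
  conorming_for X Z -> total_over Z X -> direct_sum X Y.
Proof.
move=> [_ [c [C [c0 _ XZc]]]] ZX.
apply: (@direct_sum_of_half_approximation (2 / c)) => //.
  by rewrite divr_ge0 ?ltW.
move=> e; have [->|e0] := eqVneq e 0.
  exists 0, 0; rewrite !subr0 normr0 mulr0 mul0r.
  by split=> //; exact: subspace0.
have ne0 : 0 < `|e| by rewrite normr_gt0.
(* Functionals of norm at most [c / 4] on [X] have norm at most [1 / 4], which
   is below the required factor [1 / 2]. *)
have c4 : 0 <= c / 4 by rewrite divr_ge0 ?ltW.
have [||x [y [Xx Yy xy]]] := approximate_sum hK sX sY c4 (e := e) (t := `|e| / 2).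
- by rewrite divr_ge0.
- move=> f fY fX; have Zf : Z f by exact: weak_star_closed_bipolar.
  have f4 : dual_norm f <= 4^-1.
    rewrite -(ler_pM2l c0); have /andP[/le_trans cf _] := XZc f Zf; apply: cf.
    exact: (restricted_norm_le hK sX c4 fX).
  apply: (le_lt_trans (le_dual_norm hK f e)); rewrite mulrC.
  apply: (@le_lt_trans _ _ (`|e| / 4)); first by rewrite ler_wpM2l.
  by rewrite ltr_pM2l// ltf_pV2 ?posrE// ltr_nat.
exists x, y; split=> //.
  have : c / 4 * `|x| <= `|e| / 2.
    by apply: le_trans (ltW xy); rewrite lerDl.
  rewrite -ler_pdivlMl ?divr_gt0// => /le_trans; apply.
  by rewrite le_eqVlt; apply/orP; left; apply/eqP; field; rewrite gt_eqF.
by apply: le_trans (ltW xy); rewrite lerDr mulr_ge0.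
Qed.

(** The open mapping theorem bounds the projection onto [X] along [Y]. *)
Lemma direct_sum_bounded_projection : direct_sum X Y ->
  exists2 M : K, 0 < M & forall x y, X x -> Y y -> `|x| <= M * `|x + y|.
Proof.
move=> [XY0 XYT].
have [|M M0 half] := half_approximation_of_sum hK sX sY.
  move=> e; have : [set: E] e by [].
  by rewrite -XYT => -[x Xx [y Yy <-]]; exists x, y.
exists (2 * M + 1) => [|x y Xx Yy]; first by rewrite ltr_wpDl ?mulr_ge0.
have [x' [y' [Xx' Yy' xy x'M]]] := sum_of_half_approximation hK sX cX sY
  (@preannihilator_closed _ _ Z) M0 half (x + y).
have xx' : x - x' = y' - y.
  by apply/eqP; rewrite subr_eq addrAC eq_sym subr_eq xy addrC.
have : (X `&` Y) (x - x').
  by split; [exact: subspaceB|rewrite xx'; exact: (subspaceB sY)].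
rewrite XY0 => /eqP; rewrite subr_eq0 => /eqP x_x'.
rewrite -x_x' in x'M; apply: (le_trans x'M).
by rewrite ler_wpM2r// lerDl.
Qed.

(** The distance to [Y] is a seminorm which on [X] is at least the norm divided
by a bound of the projection.  Hahn-Banach turns it into a functional of norm
at most 1 vanishing on [Y], that is, an element of the unit ball of [Z]. *)
Lemma direct_sum_norming : direct_sum X Y -> norming_for Z X.
Proof.
move=> /direct_sum_bounded_projection[M M0 XYM].
apply: (@sup_norm_equivalent E X (fun x => `|x|) (dual E) (dual_unit_ball Z)
  (fun f x => f x) M^-1).
- by exists 0; exact: dual_unit_ball0.
- exact: dual_linear.
- by move=> f x Zf _; exact: le_dual_unit_ball.
- by move=> x _ /normr0_eq0.
- by rewrite invr_gt0.
move=> x Xx.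
(* With this subspace in place of [X], [sum_cost] is the distance to [Y]. *)
have s0 : is_subspace [set 0 : E].
  by apply: is_subspaceP => // a _ _ -> ->; rewrite scaler0 addr0.
have [f [fY _ f1 fx]] := sum_cost_functional hK s0 sY (lexx 0) x.
apply: (@le_trans _ _ `|f x|).
  rewrite fx; apply: (le_sum_cost hK s0 sY (lexx 0)).
    by rewrite ger0_real// mulr_ge0// invr_ge0 ltW.
  move=> _ y -> Yy; rewrite mul0r add0r subr0 ler_pdivrMl//.
  by apply: XYM => //; rewrite -scaleN1r; exact: (subspaceZ sY).
apply: (dual_unit_ball_normP x).1; exists f => //; split.
  exact: weak_star_closed_bipolar.
by apply: (dual_norm_le hK ler01) => v; rewrite mul1r.
Qed.

(** The value of [f] at [x + y] is its value at the projection [x]. *)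
Lemma direct_sum_conorming : direct_sum X Y -> conorming_for X Z.
Proof.
move=> XY; have [M M0 XYM] := direct_sum_bounded_projection XY.
apply: (@sup_norm_equivalent (dual E) Z dual_norm E (unit_ball X)
  (fun x f => f x) M^-1).
- by exists 0; split; [exact: subspace0|rewrite normr0].
- by [].
- move=> x f [_ x1] _; apply: (le_trans (le_dual_norm hK f x)).
  by rewrite ler_piMr ?(dual_norm_ge0 hK).
- move=> f _ f0; apply/val_inj/funext => x; apply/eqP.
  by rewrite -normr_le0 (le_trans (le_dual_norm hK f x))// f0 mul0r.
- by rewrite invr_gt0.
move=> f Zf; rewrite ler_pdivrMl//.
have rn0 := restricted_norm_ge0 hK f sX.
apply: (dual_norm_le hK); first by rewrite mulr_ge0// ltW.
move=> e; have : [set: E] e by [].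
rewrite -XY.2 => -[x Xx [y Yy <-]].
have -> : f (x + y) = f x by rewrite linearD /= [f y]Yy ?addr0.
apply: (le_trans (le_restricted_norm hK f sX Xx)).
by rewrite mulrAC [leRHS]mulrC ler_wpM2l//; exact: XYM.
Qed.

End equivalences.

Theorem theorem1 (R : realType) (K : numFieldType) (hK : scalar_field R K)
    (E : completeNormedModType K) (X : set E) (Z : set (dual E))
    (hX : is_subspace X) (hXc : closed X)
    (hZ : is_subspace Z) (hZc : closed (Z : set (weak_star E))) :
  [<-> norming_for Z X /\ cototal_over X Z;
       conorming_for X Z /\ total_over Z X;
       conorming_for X Z /\ norming_for Z X;
       direct_sum X (preannihilator Z)].
Proof.
have sum_norming := direct_sum_norming hK hX hZ hXc hZc.
have sum_conorming := @direct_sum_conorming _ _ hK _ _ Z hX hXc.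
have norming_sum := norming_cototal_direct_sum hK hX hZ hXc hZc.
have conorming_sum := conorming_total_direct_sum hK hX hZ hXc hZc.
have total := norming_total hK hX hZ.
have cototal := conorming_cototal hK hX hZ.
tfae.
- move=> [ZX XZ]; split; last exact: total.
  exact: sum_conorming (norming_sum ZX XZ).
- move=> [XZ ZX]; split=> //; exact: sum_norming (conorming_sum XZ ZX).
- move=> [XZ /total ZX]; exact: conorming_sum.
- move=> XY; split; first exact: sum_norming.
  exact: cototal (sum_conorming XY).
Qed.
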